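(* Let $\{V_n:n\in\mathbb N\}$ be a family of pairwise disjoint countable subsets of the open square $(-1,1)^2$, each $V_n$ dense in $J^2$. Then for any given maps $\omega:\mathbb N\to\mathcal A$ and $\alpha:\mathbb N\to\mathcal A'$ there exists a homeomorphism $\varphi:J^2\to J^2$ such that for every $n\in\mathbb N$ and every $x\in V_n$ one has $\omega_\varphi(x)=\omega(n)$ and $\alpha_\varphi(x)=\alpha(n)$.
   Context: $J=[-1,1]$, $J_s=J\times\{s\}$. $\mathcal A$ is the collection of all nonempty connected closed subsets of $J_1$ and $\mathcal A'$ the collection of all nonempty connected closed subsets of $J_{-1}$. For a homeomorphism $g$, $\omega_g(x)$ is the $\omega$-limit set of $x$ (set of limits of $g^{n_i}(x)$ along increasing sequences of positive integers) and $\alpha_g(x)=\omega_{g^{-1}}(x)$. *)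

(* Defs.v *)
From HB Require Import structures.
From mathcomp Require Import all_boot all_order all_algebra.
From mathcomp Require Import all_classical all_reals all_analysis.
From mathcomp Require Import Rstruct Rstruct_topology.
From Stdlib Require Reals.
Notation R := Rdefinitions.R.
Set Implicit Arguments. Unset Strict Implicit. Unset Printing Implicit Defensive.
Import Order.TTheory GRing.Theory Num.Theory.
Local Open Scope classical_set_scope.
Local Open Scope ring_scope.

Definition J : set R := `[(-1)%R, 1%R].
Definition J2 : set (R * R) := J `*` J.
Definition OpenSq : set (R * R) := `](-1)%R, 1%R[ `*` `](-1)%R, 1%R[.
Definition Js (s : R) : set (R * R) := J `*` [set s].

(* members of the collection A (s = 1) resp. A' (s = -1):
   nonempty connected closed subsets of J_s *)
Definition in_coll (s : R) (C : set (R * R)) : Prop :=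
  [/\ C `<=` Js s, C !=set0, connected C & closed C].

Definition homeo_with_inv (A : set (R * R)) (f g : R * R -> R * R) : Prop :=
  [/\ (forall x, A x -> A (f x)), (forall x, A x -> A (g x)),
      (forall x, A x -> g (f x) = x) & (forall x, A x -> f (g x) = x)] /\
  ({within A, continuous f} /\ {within A, continuous g}).

Definition omega_lim (f : R * R -> R * R) (x : R * R) : set (R * R) :=
  [set y | exists ns : nat -> nat, (forall i, (ns i < ns i.+1)%N) /\
     (fun i => iter (ns i) f x) @ \oo --> y].

(* Main.v *)
Require Import Defs.
From HB Require Import structures.
From mathcomp Require Import all_boot all_order all_algebra.
From mathcomp Require Import all_classical all_reals all_analysis.
From mathcomp Require Import Rstruct Rstruct_topology.
From mathcomp Require Import ring lra zify.
From Stdlib Require Reals.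
Import Order.TTheory GRing.Theory Num.Theory numFieldNormedType.Exports.
Set Implicit Arguments.
Unset Strict Implicit.
Local Open Scope classical_set_scope.
Local Open Scope ring_scope.

(* On the open square the map is conjugate to a skew product (x, l) |-> (f_l x, l')
   whose base is a fixed point free homeomorphism of the vertical interval,
   conjugate to the translation by [s] of the line.  A generic shear and a generic
   [s] put all points of the countable set in different base orbits.  The fibre map
   f_l pulls every x towards a target T(l), by at most a step that tends to 0 at both
   ends of the base so that f extends by the identity, but slowly enough (like 1/k
   along orbits) for the sum of the steps to diverge.  By Tietze's theorem T can be
   prescribed on any locally finite part of the base orbits of the given points;
   along each of them the target alternates, on dyadic blocks of times, between the
   endpoints of the wanted limit interval.  As the steps tend to 0, the orbit sweeps
   exactly this interval.  For l < 0 the inverse of f_l does the steering, which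
   gives the alpha-limit sets. *)

(** * Increasing maps of an interval that move points towards a target, and their inverses *)

Section Steering.
Context {K : realType}.
Implicit Types t e x y : K.

(* [x] moves towards the target [t] by [min (|t - x| / 2) e]; the terms
   [(3 * x + 1) / 2] and [(3 * x - 1) / 2] keep the endpoints of [-1, 1] fixed. *)
Definition steer (t e x : K) : K :=
  Num.max (Num.max (Num.min (Num.min ((t + x) / 2) (x + e)) ((3 * x + 1) / 2))
    (x - e)) ((3 * x - 1) / 2).

(** Each affine piece of [steer] is replaced by its inverse, and max and min trade places: this
    inverts a lattice expression in increasing bijections. *)
Definition unsteer (t e y : K) : K :=
  Num.min (Num.min (Num.max (Num.max (2 * y - t) (y - e)) ((2 * y - 1) / 3))
    (y + e)) ((2 * y + 1) / 3).

(** Together with [le_steer] this makes the two maps adjoint on both sides, so bijectivity and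
    monotonicity need no case distinction on the active piece. *)
Lemma steer_le (t e x y : K) : (steer t e x <= y) = (x <= unsteer t e y).
Proof.
rewrite /steer /unsteer !ge_max !ge_min !le_min !le_max.
by congr ((_ || _ || _) && _ && _); apply/idP/idP => ?; lra.
Qed.

Lemma le_steer (t e x y : K) : (y <= steer t e x) = (unsteer t e y <= x).
Proof.
rewrite /steer /unsteer !le_max !le_min !ge_min !ge_max.
by congr (_ && _ && _ || _ || _); apply/idP/idP => ?; lra.
Qed.

Lemma steerK (t e x : K) : unsteer t e (steer t e x) = x.
Proof. by apply/eqP; rewrite eq_le -le_steer -steer_le !lexx. Qed.

Lemma unsteerK (t e x : K) : steer t e (unsteer t e x) = x.
Proof. by apply/eqP; rewrite eq_le le_steer steer_le !lexx. Qed.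

Lemma steer_dist (t e x : K) : 0 <= e -> `|x| <= 1 -> `|steer t e x - x| <= e.
Proof.
move=> e0; rewrite !ler_norml => /andP[x0 x1].
have -> : - e <= steer t e x - x by rewrite /steer lerBrDl !le_max lexx orbT.
rewrite lerBlDl /steer !ge_max !ge_min lexx orbT /=; apply/andP; split; lra.
Qed.

Lemma steer0 (t x : K) : `|x| <= 1 -> steer t 0 x = x.
Proof.
by move=> x1; apply/eqP; rewrite -subr_eq0 -normr_le0 steer_dist.
Qed.

Lemma unsteer0 (t x : K) : `|x| <= 1 -> unsteer t 0 x = x.
Proof. by move=> x1; rewrite -{1}(steer0 t x1) steerK. Qed.

Lemma steer1 (t e : K) : `|t| <= 1 -> 0 <= e -> steer t e 1 = 1.
Proof.
rewrite ler_norml => /andP[t0 t1] e0; apply/eqP; rewrite eq_le /steer.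
rewrite !le_max !ge_max !ge_min -!orbA -!andbA.
by apply/and4P; split; [apply/or3P/Or31|..|apply/or3P/Or33]; lra.
Qed.

Lemma steerN1 (t e : K) : `|t| <= 1 -> 0 <= e -> steer t e (-1) = -1.
Proof.
rewrite ler_norml => /andP[t0 t1] e0; apply/eqP; rewrite eq_le /steer.
rewrite !le_max !ge_max !ge_min !le_min -!orbA -!andbA.
apply/and4P; split; [apply/or3P/Or33|..|apply/or3P/Or31/and3P; split]; lra.
Qed.

Lemma le_steer2 (t e x y : K) : (steer t e x <= steer t e y) = (x <= y).
Proof. by rewrite steer_le steerK. Qed.

(** An increasing bijection fixing both endpoints preserves the interval and its complement. *)
Lemma steer_norm (t e x : K) : `|t| <= 1 -> 0 <= e ->
  (`|steer t e x| <= 1) = (`|x| <= 1).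
Proof.
move=> t1 e0; rewrite !ler_norml -{1}(steerN1 t1 e0) -{2}(steer1 t1 e0).
by rewrite !le_steer2.
Qed.

Lemma unsteer_norm (t e x : K) : `|t| <= 1 -> 0 <= e ->
  (`|unsteer t e x| <= 1) = (`|x| <= 1).
Proof. by move=> t1 e0; rewrite -(steer_norm _ t1 e0) unsteerK. Qed.

Lemma steer_norm_lt (t e x : K) : `|t| <= 1 -> 0 <= e ->
  (`|steer t e x| < 1) = (`|x| < 1).
Proof.
move=> t1 e0; rewrite !ltr_norml -{1}(steerN1 t1 e0) -{2}(steer1 t1 e0).
by rewrite !ltNge !le_steer2.
Qed.

Lemma unsteer_norm_lt (t e x : K) : `|t| <= 1 -> 0 <= e ->
  (`|unsteer t e x| < 1) = (`|x| < 1).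
Proof. by move=> t1 e0; rewrite -(steer_norm_lt _ t1 e0) unsteerK. Qed.

Lemma steer_ge_min (t e x : K) : 0 <= e -> `|x| <= 1 ->
  Num.min x t <= steer t e x.
Proof.
move=> e0; rewrite ler_norml => /andP[x0 x1].
rewrite /steer !le_max !le_min !ge_min -!orbA -!andbA.
case: (leP x t) => xt; first by apply/or3P/Or31/and3P; split; apply/orP; left; lra.
apply/or3P/Or31/and3P; split; apply/orP; right; lra.
Qed.

Lemma steer_le_max (t e x : K) : 0 <= e -> `|x| <= 1 ->
  steer t e x <= Num.max x t.
Proof.
move=> e0; rewrite ler_norml => /andP[x0 x1].
rewrite /steer !ge_max !ge_min !le_max -!orbA -!andbA.
case: (leP x t) => xt; apply/and3P; split; apply/orP; try by (right; lra).
all: by left; lra.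
Qed.

(* The margin condition [`|x| <= 1 - 2 * e] makes the endpoint terms inactive. *)
Lemma steer_down (t e x : K) : 0 <= e -> `|x| <= 1 - 2 * e -> 2 * e <= x - t ->
  steer t e x = x - e.
Proof.
move=> e0; rewrite ler_norml => /andP[x0 x1] xt; apply/eqP; rewrite eq_le /steer.
rewrite !le_max lexx orbT andbT !ge_max !ge_min -!orbA -!andbA.
apply/and3P; split; [apply/orP; left; lra|lra|lra].
Qed.

Lemma steer_up (t e x : K) : 0 <= e -> `|x| <= 1 - 2 * e -> 2 * e <= t - x ->
  steer t e x = x + e.
Proof.
move=> e0; rewrite ler_norml => /andP[x0 x1] xt; apply/eqP; rewrite eq_le /steer.
rewrite !le_max !le_min !ge_max !ge_min !lexx -!orbA -!andbA.
apply/and4P; split; [by rewrite orbT|lra|lra|].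
by apply/or3P/Or31/and3P; split; lra.
Qed.

End Steering.

(** * Translations of the line, compactified to [-1, 1] *)

Section Slide.
Context {K : realType}.
Implicit Types s t y : K.

Definition squash (t : K) : K := t / (1 + `|t|).

Definition unsquash (y : K) : K := y / (1 - `|y|).

(* The flow on [-1, 1] conjugate under [squash] to the translation by [s]; this
   expression also makes sense at the fixed points [1] and [-1]. *)
Definition slide (s y : K) : K :=
  (y + s * (1 - `|y|)) / ((1 - `|y|) + `|y + s * (1 - `|y|)|).

Lemma squash_norm (t : K) : 1 - `|squash t| = (1 + `|t|)^-1.
Proof.
rewrite /squash normrM normfV (ger0_norm (addr_ge0 ler01 (normr_ge0 t))).
have := normr_ge0 t; move: `|t| => u u0; field; lra.
Qed.

Lemma squash_norm_lt1 (t : K) : `|squash t| < 1.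
Proof. by rewrite -subr_gt0 squash_norm invr_gt0 ltr_wpDr. Qed.

Lemma squashK (t : K) : unsquash (squash t) = t.
Proof.
rewrite /unsquash squash_norm invrK /squash.
have := normr_ge0 t; move: `|t| => u u0; field; lra.
Qed.

Lemma unsquashK (y : K) : `|y| < 1 -> squash (unsquash y) = y.
Proof.
move=> y1; rewrite /squash /unsquash normrM normfV [`|1 - _|]ger0_norm ?subr_ge0 ?ltW//.
by move: `|y| y1 => u u1; field; lra.
Qed.

Lemma slide_squash (s t : K) : slide s (squash t) = squash (t + s).
Proof.
rewrite /slide squash_norm.
have u0 : 0 < 1 + `|t| by have := normr_ge0 t; lra.
have -> : squash t + s * (1 + `|t|)^-1 = (t + s) / (1 + `|t|).
  by rewrite /squash; field; lra.
rewrite normrM normfV (gtr0_norm u0) /squash.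
have := normr_ge0 (t + s); move: `|t + s| (1 + `|t|) u0 => v u u0 v0; field; lra.
Qed.

Lemma slide1 (s : K) : slide s 1 = 1.
Proof. by rewrite /slide normr1 subrr mulr0 addr0 normr1 add0r divr1. Qed.

Lemma slideN1 (s : K) : slide s (-1) = -1.
Proof. by rewrite /slide normrN1 subrr mulr0 addr0 normrN1 add0r divr1. Qed.

(** Reduces statements about [slide] to its two fixed points and to translations of the line. *)
Lemma segment_cases (P : K -> Prop) : P 1 -> P (-1) -> (forall t, P (squash t)) ->
  forall y, `|y| <= 1 -> P y.
Proof.
move=> P1 PN1 Pt y; rewrite le_eqVlt => /orP[|/unsquashK <-//].
by rewrite eqr_norml ler01 andbT => /orP[] /eqP ->.
Qed.

Lemma slide_slide (r s y : K) : `|y| <= 1 -> slide r (slide s y) = slide (s + r) y.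
Proof.
apply: (@segment_cases (fun y => slide r (slide s y) = slide (s + r) y)) => [||t].
- by rewrite !slide1.
- by rewrite !slideN1.
- by rewrite !slide_squash addrA.
Qed.

Lemma slide0 (y : K) : slide 0 y = y.
Proof. by rewrite /slide mul0r addr0 subrK divr1. Qed.

Lemma slide_norm (s y : K) : `|y| <= 1 -> `|slide s y| <= 1.
Proof.
apply: (@segment_cases (fun y => `|slide s y| <= 1)) => [||t].
- by rewrite slide1 normr1.
- by rewrite slideN1 normrN1.
- by rewrite slide_squash ltW ?squash_norm_lt1.
Qed.

Section Continuity.
Context {U : Type} {F : set_system U} {FF : Filter F}.

Lemma cvg_min (f g : U -> K) (a b : K) :
  f @ F --> a -> g @ F --> b -> (fun u => Num.min (f u) (g u)) @ F --> Num.min a b.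
Proof.
move=> fa gb.
have -> : (fun u => Num.min (f u) (g u)) = (fun u => (f u + g u - `|f u - g u|) / 2).
  by apply/funext => u; rewrite minr_absE.
rewrite minr_absE; apply: cvgM; last exact: cvg_cst.
by apply: cvgB; [exact: cvgD|apply: cvg_norm; exact: cvgB].
Qed.

Lemma cvg_max (f g : U -> K) (a b : K) :
  f @ F --> a -> g @ F --> b -> (fun u => Num.max (f u) (g u)) @ F --> Num.max a b.
Proof.
move=> fa gb.
have -> : (fun u => Num.max (f u) (g u)) = (fun u => (f u + g u + `|f u - g u|) / 2).
  by apply/funext => u; rewrite maxr_absE.
rewrite maxr_absE; apply: cvgM; last exact: cvg_cst.
by apply: cvgD; [exact: cvgD|apply: cvg_norm; exact: cvgB].
Qed.

Lemma cvg_steer (t e x : U -> K) (t0 e0 x0 : K) :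
  t @ F --> t0 -> e @ F --> e0 -> x @ F --> x0 ->
  (fun u => steer (t u) (e u) (x u)) @ F --> steer t0 e0 x0.
Proof.
move=> ct ce cx; rewrite /steer.
apply: cvg_max; first apply: cvg_max; first apply: cvg_min; first apply: cvg_min.
- by apply: cvgM; [exact: (cvgD ct cx)|exact: cvg_cst].
- exact: (cvgD cx ce).
- by apply: cvgM; [apply: cvgD; [apply: cvgM|]|]; solve [exact: cvg_cst|assumption].
- exact: (cvgB cx ce).
- by apply: cvgM; [apply: cvgB; [apply: cvgM|]|]; solve [exact: cvg_cst|assumption].
Qed.

Lemma cvg_unsteer (t e x : U -> K) (t0 e0 x0 : K) :
  t @ F --> t0 -> e @ F --> e0 -> x @ F --> x0 ->
  (fun u => unsteer (t u) (e u) (x u)) @ F --> unsteer t0 e0 x0.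
Proof.
move=> ct ce cx; rewrite /unsteer.
apply: cvg_min; first apply: cvg_min; first apply: cvg_max; first apply: cvg_max.
- by apply: cvgB => //; apply: cvgM => //; exact: cvg_cst.
- exact: (cvgB cx ce).
- by apply: cvgM; [apply: cvgB; [apply: cvgM|]|]; solve [exact: cvg_cst|assumption].
- exact: (cvgD cx ce).
- by apply: cvgM; [apply: cvgD; [apply: cvgM|]|]; solve [exact: cvg_cst|assumption].
Qed.

(* No convergence of the target is needed where the step size vanishes. *)
Lemma cvg_steer_small (t e x : U -> K) (x0 : K) :
  (\forall u \near F, 0 <= e u /\ `|x u| <= 1) ->
  e @ F --> (0 : K) -> x @ F --> x0 ->
  (fun u => steer (t u) (e u) (x u)) @ F --> x0.
Proof.
move=> ex ce cx.
apply: (@squeeze_cvgr _ _ _ _ (fun u => x u - e u) (fun u => x u + e u)).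
- apply: filterS ex => u [e0 x1].
  by rewrite -ler_distl steer_dist.
- by rewrite -[X in _ --> X]subr0; exact: cvgB.
- by rewrite -[X in _ --> X]addr0; exact: cvgD.
Qed.

(** The displacement is that of [steer] at the preimage of [x], which lies in [-1, 1] by the bound
    on [t]. *)
Lemma unsteer_dist (t e x : K) : `|t| <= 1 -> 0 <= e -> `|x| <= 1 ->
  `|unsteer t e x - x| <= e.
Proof.
move=> t1 e0 x1; rewrite distrC -{1}(unsteerK t e x).
by rewrite steer_dist // unsteer_norm.
Qed.

Lemma cvg_unsteer_small (t e x : U -> K) (x0 : K) :
  (\forall u \near F, [/\ `|t u| <= 1, 0 <= e u & `|x u| <= 1]) ->
  e @ F --> (0 : K) -> x @ F --> x0 ->
  (fun u => unsteer (t u) (e u) (x u)) @ F --> x0.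
Proof.
move=> ex ce cx.
apply: (@squeeze_cvgr _ _ _ _ (fun u => x u - e u) (fun u => x u + e u)).
- apply: filterS ex => u [t1 e0 x1].
  by rewrite -ler_distl unsteer_dist.
- by rewrite -[X in _ --> X]subr0; exact: cvgB.
- by rewrite -[X in _ --> X]addr0; exact: cvgD.
Qed.

Lemma cvg_slide (s y : U -> K) (s0 y0 : K) : `|y0| <= 1 ->
  s @ F --> s0 -> y @ F --> y0 -> (fun u => slide (s u) (y u)) @ F --> slide s0 y0.
Proof.
move=> y1 cs cy; rewrite /slide.
have cw : (fun u => 1 - `|y u|) @ F --> 1 - `|y0|.
  by apply: cvgB; [exact: cvg_cst|exact: cvg_norm].
have cn : (fun u => y u + s u * (1 - `|y u|)) @ F --> y0 + s0 * (1 - `|y0|).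
  by apply: cvgD => //; exact: cvgM.
apply: cvgM => //; apply: cvgV; last by apply: cvgD => //; exact: cvg_norm.
(* The limit of the denominator is nonzero: its first term is positive if [|y0| < 1], and it equals
   1 if [|y0| = 1]. *)
move: y1; rewrite le_eqVlt => /orP[/eqP y1|y1]; last first.
  by rewrite gt_eqF // ltr_pwDl ?normr_ge0 // subr_gt0.
by rewrite y1 subrr mulr0 addr0 add0r y1 oner_eq0.
Qed.

Lemma cvg_unsquash (y : U -> K) (y0 : K) : `|y0| < 1 ->
  y @ F --> y0 -> (fun u => unsquash (y u)) @ F --> unsquash y0.
Proof.
move=> y1 cy; apply: cvgM => //; apply: cvgV.
  by rewrite gt_eqF // subr_gt0.
by apply: cvgB; [exact: cvg_cst|exact: cvg_norm].
Qed.

End Continuity.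

End Slide.

(** * The skew product on the square and its continuity *)

Section Homeomorphism.
Context {K : realType}.
Implicit Types l x : K.

(** Positive only on (0, 1), so [gain l] and [gain (- l)] are never both positive. Near 1 it is half
    the distance to the end, that is [1 / (2 * (1 + t))] at [l = squash t]; its sum along a
    progression tending to 1 in this coordinate diverges. *)
Definition gain l : K := Num.max 0 (Num.min l (1 - l)) / 2.

Lemma gain_ge0 l : 0 <= gain l.
Proof. by rewrite /gain divr_ge0 // le_max lexx. Qed.

Lemma gain_near1 l : 1 / 2 <= l -> l <= 1 -> gain l = (1 - l) / 2.
Proof.
by move=> l0 l1; rewrite /gain min_r ?max_r //; lra.
Qed.

Lemma gain_le0 l : l <= 0 -> gain l = 0.
Proof.
by move=> l0; rewrite /gain min_l ?max_l ?mul0r //; lra.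
Qed.

Variable T : K -> K.
Hypothesis T_cont : continuous T.
Hypothesis T_le1 : forall t, `|T t| <= 1.

(** The factor [|l|] keeps the target at distance at least [1 - |l|] from both endpoints, twice the
    step size near the ends of the base, and disappears in the limit. At [|l| = 1] division by zero
    gives a junk value, but the steps vanish there. *)
Definition target l : K := `|l| * T (unsquash l).

(* For [l > 0] this steers towards [target l], for [l < 0] its inverse does. *)
Definition push x l : K :=
  unsteer (target l) (gain (- l)) (steer (target l) (gain l) x).

Definition pull x l : K :=
  unsteer (target l) (gain l) (steer (target l) (gain (- l)) x).

Lemma pushK x l : pull (push x l) l = x.
Proof. by rewrite /pull /push unsteerK steerK. Qed.

Lemma pullK x l : push (pull x l) l = x.
Proof. by rewrite /pull /push unsteerK steerK. Qed.

Lemma target_le l : `|l| <= 1 -> `|target l| <= `|l|.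
Proof.
by move=> l1; rewrite /target normrM normr_id ler_piMr.
Qed.

Lemma target_le1 l : `|l| <= 1 -> `|target l| <= 1.
Proof. by move=> l1; rewrite (le_trans (target_le l1)). Qed.

Lemma push_norm x l : `|l| <= 1 -> (`|push x l| <= 1) = (`|x| <= 1).
Proof.
by move=> l1; rewrite unsteer_norm ?steer_norm ?gain_ge0 ?target_le1.
Qed.

Lemma pull_norm x l : `|l| <= 1 -> (`|pull x l| <= 1) = (`|x| <= 1).
Proof.
by move=> l1; rewrite unsteer_norm ?steer_norm ?gain_ge0 ?target_le1.
Qed.

Lemma push_norm_lt x l : `|l| <= 1 -> (`|push x l| < 1) = (`|x| < 1).
Proof.
by move=> l1; rewrite unsteer_norm_lt ?steer_norm_lt ?gain_ge0 ?target_le1.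
Qed.

Lemma pull_norm_lt x l : `|l| <= 1 -> (`|pull x l| < 1) = (`|x| < 1).
Proof.
by move=> l1; rewrite unsteer_norm_lt ?steer_norm_lt ?gain_ge0 ?target_le1.
Qed.

Lemma push_near1 x l : 1 / 2 <= l -> l <= 1 -> `|x| <= 1 ->
  push x l = steer (target l) ((1 - l) / 2) x.
Proof.
move=> l0 l1 x1; rewrite /push (@gain_near1 l) // (@gain_le0 (- l)); last lra.
rewrite unsteer0 // steer_norm // ?target_le1 ?ler_norml; lra.
Qed.

Lemma pull_nearN1 x l : 1 / 2 <= - l -> - l <= 1 -> `|x| <= 1 ->
  pull x l = steer (target l) ((1 + l) / 2) x.
Proof.
move=> l0 l1 x1; rewrite /pull (@gain_near1 (- l)) // (@gain_le0 l); last lra.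
rewrite opprK unsteer0 // steer_norm // ?target_le1 ?ler_norml; lra.
Qed.

Section Continuity.
Context {U : Type} {F : set_system U} {FF : Filter F}.
Variables (x l : U -> K) (x0 l0 : K).
Hypothesis F1 : \forall u \near F, `|x u| <= 1 /\ `|l u| <= 1.
Hypothesis cx : x @ F --> x0.
Hypothesis cl : l @ F --> l0.
Hypothesis x01 : `|x0| <= 1.
Hypothesis l01 : `|l0| <= 1.

Lemma cvg_gain (m : U -> K) (m0 : K) : m @ F --> m0 ->
  (fun u => gain (m u)) @ F --> gain m0.
Proof.
move=> cm; rewrite /gain; apply: cvgM; last exact: cvg_cst.
apply: cvg_max; first exact: cvg_cst.
by apply: cvg_min => //; apply: cvgB => //; exact: cvg_cst.
Qed.

(** At [|l0| = 1] the target need not converge, but both steps tend to 0 there. The abstract [m] and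
    [m'] serve [push] and [pull] alike. *)
Lemma cvg_unsteer_steer (m m' : U -> K) (m0 m0' : K) :
  m @ F --> m0 -> m' @ F --> m0' ->
  (`|l0| = 1 -> gain m0 = 0 /\ gain m0' = 0) ->
  (fun u => unsteer (target (l u)) (gain (m u))
     (steer (target (l u)) (gain (m' u)) (x u))) @ F -->
  unsteer (target l0) (gain m0) (steer (target l0) (gain m0') x0).
Proof.
move=> /cvg_gain cm /cvg_gain cm' lm.
move: l01; rewrite le_eqVlt => /orP[/eqP l1|l1]; last first.
  have ct : (fun u => target (l u)) @ F --> target l0.
    apply: cvgM; first exact: cvg_norm.
    by apply: continuous_cvg; [exact: T_cont|exact: cvg_unsquash].
  by apply: cvg_unsteer => //; exact: cvg_steer.
have [g0 g0'] := lm l1.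
rewrite g0 in cm *; rewrite g0' in cm' *.
rewrite unsteer0 steer0 //; apply: cvg_unsteer_small => //.
  apply: filterS F1 => u [x1 lu1].
  by rewrite gain_ge0 steer_norm ?target_le1 // gain_ge0.
apply: cvg_steer_small => //.
by apply: filterS F1 => u [x1 lu1]; rewrite gain_ge0.
Qed.

Lemma gain_norm1 : `|l0| = 1 -> gain l0 = 0 /\ gain (- l0) = 0.
Proof.
move=> /eqP; rewrite eqr_norml ler01 andbT => /orP[] /eqP ->.
- by rewrite (@gain_near1 1) ?(@gain_le0 (-1)) ?subrr ?mul0r //; lra.
- by rewrite opprK (@gain_near1 1) ?(@gain_le0 (-1)) ?subrr ?mul0r //; lra.
Qed.

Lemma cvg_push : (fun u => push (x u) (l u)) @ F --> push x0 l0.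
Proof.
apply: cvg_unsteer_steer => //; first exact: cvgN.
by move=> /gain_norm1[-> ->].
Qed.

Lemma cvg_pull : (fun u => pull (x u) (l u)) @ F --> pull x0 l0.
Proof.
apply: cvg_unsteer_steer => //; first exact: cvgN.
exact: gain_norm1.
Qed.

End Continuity.

Variables c s : K.

(* In the coordinates [(x, slide (c * x) y)] this is the skew product
   [(x, l) |-> (push x l, slide s l)]. *)
Definition flow (p : K * K) : K * K :=
  let l := slide (c * p.1) p.2 in let x := push p.1 l in
  (x, slide (- (c * x)) (slide s l)).

Definition flowV (p : K * K) : K * K :=
  let l := slide (- s) (slide (c * p.1) p.2) in let x := pull p.1 l in
  (x, slide (- (c * x)) l).

Let Q : set (K * K) := [set p | `|p.1| <= 1 /\ `|p.2| <= 1].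

Lemma flow_stable p : Q p -> Q (flow p).
Proof.
move=> [x1 y1]; have l1 := slide_norm (c * p.1) y1.
by split; rewrite /= ?push_norm // !slide_norm.
Qed.

Lemma flowV_stable p : Q p -> Q (flowV p).
Proof.
move=> [x1 y1]; have l1 := slide_norm (- s) (slide_norm (c * p.1) y1).
by split; rewrite /= ?pull_norm // !slide_norm.
Qed.

Lemma flowK p : Q p -> flowV (flow p) = p.
Proof.
case: p => x y [/= x1 y1]; rewrite /flowV /flow /=.
have l1 := slide_norm (c * x) y1; have sl1 := slide_norm s l1.
rewrite (slide_slide (c * _)) // addNr slide0.
by rewrite slide_slide // subrr slide0 pushK slide_slide // subrr slide0.
Qed.

Lemma flowVK p : Q p -> flow (flowV p) = p.
Proof.
case: p => x y [/= x1 y1]; rewrite /flowV /flow /=.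
have l1 := slide_norm (c * x) y1; have sl1 := slide_norm (- s) l1.
rewrite (slide_slide (c * _)) // addNr slide0 pullK.
by rewrite (slide_slide s) // addNr slide0 slide_slide // subrr slide0.
Qed.

Lemma within_fst_snd (p0 : K * K) : [/\ fst @ within Q (nbhs p0) --> p0.1,
  snd @ within Q (nbhs p0) --> p0.2 & \forall p \near within Q (nbhs p0), Q p].
Proof.
split.
- by apply: cvg_within_filter; exact: cvg_fst.
- by apply: cvg_within_filter; exact: cvg_snd.
- exact: withinT.
Qed.

Lemma flow_continuous : {within Q, continuous flow}.
Proof.
apply/subspace_continuousP => p0 [x1 y1].
have [cf cs nQ] := within_fst_snd p0.
set F := within Q (nbhs p0) in cf cs nQ *.
have cl : (fun p => slide (c * p.1) p.2) @ F --> slide (c * p0.1) p0.2.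
  by apply: cvg_slide => //; apply: cvgM => //; exact: cvg_cst.
have l1 := slide_norm (c * p0.1) y1.
have cp : (fun p => push p.1 (slide (c * p.1) p.2)) @ F -->
    push p0.1 (slide (c * p0.1) p0.2).
  apply: cvg_push => //; apply: filterS nQ => p [? ?]; split => //.
  exact: slide_norm.
have cy : (fun p => (flow p).2) @ F --> (flow p0).2.
  apply: cvg_slide; first exact: slide_norm.
    by apply: cvgN; apply: cvgM => //; exact: cvg_cst.
  by apply: cvg_slide => //; exact: cvg_cst.
exact: (cvg_pair cp cy).
Qed.

Lemma flowV_continuous : {within Q, continuous flowV}.
Proof.
apply/subspace_continuousP => p0 [x1 y1].
have [cf cs nQ] := within_fst_snd p0.
set F := within Q (nbhs p0) in cf cs nQ *.
have l1 := slide_norm (- s) (slide_norm (c * p0.1) y1).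
have cl : (fun p => slide (- s) (slide (c * p.1) p.2)) @ F -->
    slide (- s) (slide (c * p0.1) p0.2).
  apply: cvg_slide; [exact: slide_norm|exact: cvg_cst|].
  by apply: cvg_slide => //; apply: cvgM => //; exact: cvg_cst.
have cp : (fun p => pull p.1 (slide (- s) (slide (c * p.1) p.2))) @ F -->
    pull p0.1 (slide (- s) (slide (c * p0.1) p0.2)).
  apply: cvg_pull => //; apply: filterS nQ => p [? ?]; split => //.
  by apply: slide_norm; exact: slide_norm.
have cy : (fun p => (flowV p).2) @ F --> (flowV p0).2.
  apply: cvg_slide => //.
  by apply: cvgN; apply: cvgM => //; exact: cvg_cst.
exact: (cvg_pair cp cy).
Qed.

End Homeomorphism.

(** * Sequences chasing a moving target with decreasing steps *)

Section Tracking.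
Context {K : realType}.
Variables (x e t : nat -> K) (v : bool -> K) (k0 : nat).
Hypothesis x_step : forall k, (k0 <= k)%N -> x k.+1 = steer (t k) (e k) (x k).
Hypothesis x_start : `|x k0| < 1.
Hypothesis e_ge0 : forall k, (k0 <= k)%N -> 0 <= e k.
Hypothesis e_step : forall k, (k0 <= k)%N -> e k.+1 <= e k.
Hypothesis e_cvg0 : e @ \oo --> (0 : K).
Hypothesis t_margin : forall k, (k0 <= k)%N -> `|t k| <= 1 - 2 * e k.
(** A blockwise form of divergence: as the steps decrease, full steps throughout a late dyadic block
    would cover more than the width 2 of [-1, 1]. *)
Hypothesis e_dyadic : \forall m \near \oo, 2 < (2 ^ m)%:R * e (2 ^ m.+1)%N.
Hypothesis v_le1 : forall q, `|v q| <= 1.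
Hypothesis t_cvg : (fun k => t k - v (odd (trunc_log 2 k))) @ \oo --> (0 : K).

Lemma t_le1 k : (k0 <= k)%N -> `|t k| <= 1.
Proof.
by move=> kk; have := t_margin kk; have := e_ge0 kk; lra.
Qed.

Lemma e_noninc k l : (k0 <= k)%N -> (k <= l)%N -> e l <= e k.
Proof.
move=> kk /subnK <-; elim: (l - k)%N => [//|n IH]; rewrite addSn.
by rewrite (le_trans _ IH) // e_step // (leq_trans kk) // leq_addl.
Qed.

Lemma e_small (h : K) : 0 < h -> exists N, forall k, (N <= k)%N -> e k <= h.
Proof.
move=> h0; have [N _ eN] := cvgr_le (0 : K) e_cvg0 h h0.
by exists N => k Nk; exact: eN.
Qed.

Lemma t_close (h : K) : 0 < h ->
  exists N, forall k, (N <= k)%N -> `|t k - v (odd (trunc_log 2 k))| <= h.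
Proof.
move=> h0; have [N _ eN] := (cvgrPdist_le _ _).1 t_cvg h h0.
by exists N => k /eN; rewrite sub0r normrN.
Qed.

Lemma x_lt1 k : (k0 <= k)%N -> `|x k| < 1.
Proof.
move=> /subnK <-; elim: (k - k0)%N => [//|n IH]; rewrite addSn.
by rewrite x_step ?leq_addl // steer_norm_lt ?t_le1 ?e_ge0 ?leq_addl.
Qed.

Lemma x_le1 k : (k0 <= k)%N -> `|x k| <= 1.
Proof. by move=> /x_lt1/ltW. Qed.

Lemma x_dist k : (k0 <= k)%N -> `|x k.+1 - x k| <= e k.
Proof. by move=> kk; rewrite x_step // steer_dist ?e_ge0 ?x_le1. Qed.

Lemma x_between k : (k0 <= k)%N ->
  Num.min (x k) (t k) <= x k.+1 /\ x k.+1 <= Num.max (x k) (t k).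
Proof.
by move=> kk; rewrite x_step // steer_ge_min ?steer_le_max ?e_ge0 ?x_le1.
Qed.

Lemma x_norm_step k : (k0 <= k)%N -> `|x k.+1| <= Num.max `|x k| `|t k|.
Proof.
move=> kk; have [] := x_between kk; rewrite ge_min le_max => lo hi.
rewrite ler_norml lerNl !le_max; apply/andP; split.
- case/orP: lo => lo; apply/orP; [left|right];
    by rewrite lerNl (le_trans _ lo) // lerNl -normrN ler_norm.
- case/orP: hi => hi; apply/orP; [left|right];
    by rewrite (le_trans hi) // ler_norm.
Qed.

(** Once true, the bound persists: [|x|] can only grow up to [|t|], which obeys it, and the margin
    shrinks. Were it never true, [|x|] would always exceed [|t|], hence never grow, and stay below
    [|x k0| < 1], while [1 - 2 * e k] tends to 1. *)
Lemma x_margin : exists k1, forall k, (k1 <= k)%N -> `|x k| <= 1 - 2 * e k.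
Proof.
have [[k1 [kk1 x1]]|no] :=
    pselect (exists k, (k0 <= k)%N /\ `|x k| <= 1 - 2 * e k).
  exists k1 => k /subnK <-; elim: (k - k1)%N => [//|n IH]; rewrite addSn.
  have kn : (k0 <= n + k1)%N by rewrite (leq_trans kk1) ?leq_addl.
  apply: (le_trans (x_norm_step kn)); rewrite ge_max.
  by have := t_margin kn; have := e_step kn; move: IH; lra.
have big k : (k0 <= k)%N -> 1 - 2 * e k < `|x k|.
  by move=> kk; rewrite ltNge; apply/negP => xk; apply: no; exists k.
have dec k : (k0 <= k)%N -> `|x k| <= `|x k0|.
  move=> /subnK <-; elim: (k - k0)%N => [//|n IH]; rewrite addSn.
  have kn : (k0 <= n + k0)%N by rewrite leq_addl.
  rewrite (le_trans _ IH) // (le_trans (x_norm_step kn)) // ge_max lexx /=.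
  by have := t_margin kn; have := big _ kn; lra.
have h0 : 0 < (1 - `|x k0|) / 2 by rewrite divr_gt0 // subr_gt0.
have [N eN] := e_small h0.
have Nk : (k0 <= maxn k0 N)%N by rewrite leq_maxl.
have := big _ Nk; have := dec _ Nk; have := eN _ (leq_maxr k0 N); lra.
Qed.

(* While [x] is further than [h] from the constant [v q] governing a dyadic
   block, it moves by the full step [e k], and the block is too long for that. *)
Lemma x_visits (q : bool) (h : K) N : 0 < h ->
  exists2 k, (N <= k)%N & `|x k - v q| <= h.
Proof.
move=> h0; apply: contrapT => no.
have far k : (N <= k)%N -> h < `|x k - v q|.
  by move=> Nk; rewrite ltNge; apply/negP => xk; apply: no; exists k.
have [k1 xm] := x_margin.
(* With the target within [h / 4] of [v q] and steps at most [h / 8], a point further than [h] from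
   [v q] makes a full step and stays on its side of [v q]. *)
have h40 : 0 < h / 4 by rewrite divr_gt0.
have h80 : 0 < h / 8 by rewrite divr_gt0.
have [N1 tN1] := t_close h40.
have [N2 eN2] := e_small h80.
have [m0 _ em0] := e_dyadic.
pose M := (k0 + k1 + N + N1 + N2 + m0)%N.
have M_le n : (M <= n)%N ->
    [/\ (k0 <= n)%N, (k1 <= n)%N, (N <= n)%N, (N1 <= n)%N & (N2 <= n)%N].
  by rewrite /M => Mn; split; lia.
(* A block beyond all thresholds whose parity selects [v q]. *)
pose m := (M + (odd M (+) q))%N.
have mq : odd m = q by rewrite /m oddD oddb addKb.
have mM : (M <= m)%N by rewrite leq_addr.
have mP : (m <= 2 ^ m)%N by rewrite ltnW // ltn_expl.
have Mk i : (M <= i + 2 ^ m)%N.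
  by rewrite (leq_trans mM) // (leq_trans mP) // leq_addl.
have e2 : 2 < (2 ^ m)%:R * e (2 ^ m.+1)%N.
  by apply: em0 => /=; move: mM; rewrite /M; lia.
(* Each move gains at least the step size at the end of the block; after all [2 ^ m] moves the
   distance, at most 2 at first, would be negative. *)
have step i : (i <= 2 ^ m)%N ->
    `|x (i + 2 ^ m)%N - v q| <= `|x (2 ^ m)%N - v q| - i%:R * e (2 ^ m.+1)%N.
  elim: i => [_|i IH im]; first by rewrite mul0r subr0.
  have {}IH := IH (ltnW im).
  have [kk kk1 kN kN1 kN2] := M_le _ (Mk i).
  rewrite addSn; set k := (i + 2 ^ m)%N in IH kk kk1 kN kN1 kN2 *.
  have tk : odd (trunc_log 2 k) = q.
    rewrite -mq; congr odd; apply: trunc_log_eq => //.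
    by rewrite leq_addl expnS mul2n -addnn ltn_add2r im.
  have {tk}tk : `|t k - v q| <= h / 4 by rewrite -tk; exact: tN1.
  have fk : h < `|x k - v q| by exact: far.
  have ek : e k <= h / 8 by exact: eN2.
  have xk : `|x k| <= 1 - 2 * e k by exact: xm.
  have ek' : e (2 ^ m.+1)%N <= e k.
    by apply: e_noninc => //; rewrite expnS mul2n -addnn leq_add2r ltnW.
  have ek0 := e_ge0 kk.
  rewrite -natr1 mulrDl mul1r x_step //.
  have [xv|xv] := leP (v q) (x k).
    move: fk IH; rewrite ger0_norm ?subr_ge0 // => fk IH.
    have /andP[tk1 tk2] : - (h / 4) <= t k - v q <= h / 4 by rewrite -ler_norml.
    rewrite steer_down //; last lra.
    by rewrite ger0_norm; lra.
  move: fk IH; rewrite ltr0_norm ?subr_lt0 // => fk IH.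
  have /andP[tk1 tk2] : - (h / 4) <= t k - v q <= h / 4 by rewrite -ler_norml.
  rewrite steer_up //; last lra.
  by rewrite ler0_norm; lra.
have := step _ (leqnn _); move: e2; move: (_%:R * e _) => P P2.
have [kk _ _ _ _] := M_le _ (leq_trans mM mP).
have nB : `|x (2 ^ m)%N - v q| <= `|x (2 ^ m)%N| + `|v q| := ler_normB _ _.
have n0 : 0 <= `|x (2 ^ m + 2 ^ m)%N - v q| := normr_ge0 _.
have := x_le1 kk; have := v_le1 q; lra.
Qed.

(** After a visit near [v true], each new point lies between the old one and a target, both already
    in the enlarged interval. *)
Lemma x_confined (lo hi h : K) : 0 < h -> (forall q, lo <= v q /\ v q <= hi) ->
  exists N, forall k, (N <= k)%N -> lo - h <= x k /\ x k <= hi + h.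
Proof.
move=> h0 vlh; have [N tN] := t_close h0.
have [k1 k1M xk1] := x_visits true (k0 + N)%N h0.
exists k1 => k /subnK <-; elim: (k - k1)%N => [|n [IHl IHh]].
  have [vl vh] := vlh true; move: xk1; rewrite add0n ler_distl; lra.
rewrite addSn; set k' := (n + k1)%N in IHl IHh *.
have kk : (k0 <= k')%N by rewrite /k'; move: k1M; lia.
have tk : `|t k' - v (odd (trunc_log 2 k'))| <= h.
  by apply: tN; rewrite /k'; move: k1M; lia.
have [vl vh] := vlh (odd (trunc_log 2 k')).
have [] := x_between kk; rewrite ge_min le_max => lo' hi'.
move: tk; rewrite ler_distl => /andP[t1 t2].
by split; [case/orP: lo'|case/orP: hi']; lra.
Qed.

(* Discrete intermediate value theorem between a visit near [v true] and a
   later one near [v false]; the steps tend to [0]. *)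
Lemma x_hits (u h : K) N : 0 < h -> v true <= u -> u <= v false ->
  exists2 k, (N <= k)%N & `|x k - u| <= h.
Proof.
move=> h0 au ub; have [N1 eN1] := e_small h0.
have [k1 k1M xk1] := x_visits true (k0 + N + N1)%N h0.
have [k2 k2M xk2] := x_visits false k1 h0.
have ex : exists k, (k1 <= k)%N && (u - h <= x k).
  by exists k2; rewrite k2M /=; move: xk2; rewrite ler_distl; lra.
(* The first time at or above [u - h]: either [k1], where [x] is at most [v true + h], or one step
   of size at most [h] after a point below [u - h]. *)
have [k /andP[k1k xk] kmin] := ex_minnP ex.
exists k; first by move: k1M k1k; lia.
rewrite ler_distl xk /=.
have [kk1|[k1k' k_gt0]] : k = k1 \/ (k1 <= k.-1)%N /\ (0 < k)%N.
  by move: k1k; lia.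
  by move: xk1; rewrite kk1 ler_distl; lra.
have xk' : x k.-1 < u - h.
  rewrite ltNge; apply/negP => xk'.
  by have := kmin k.-1; rewrite k1k' xk' => /(_ isT); lia.
have [kk N1k] : (k0 <= k.-1)%N /\ (N1 <= k.-1)%N.
  by move: k1M k1k'; split; lia.
have := x_dist kk; rewrite prednK // ler_distl => /andP[_ up].
by have := eN1 _ N1k; lra.
Qed.

End Tracking.

(** * Limit sets of sequences and of steered orbits *)

Lemma subsequence_cvg {K : realType} (x : nat -> K) (u : K) :
  (forall h N, 0 < h -> exists2 k, (N <= k)%N & `|x k - u| <= h) ->
  exists2 ns : nat -> nat, (forall i, (ns i < ns i.+1)%N) & x \o ns @ \oo --> u.
Proof.
move=> near_u.
have /choice [pick pickP] (iN : nat * nat) :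
    exists k, (iN.2 <= k)%N /\ `|x k - u| <= iN.1.+1%:R^-1.
  have [|k] := near_u iN.1.+1%:R^-1 iN.2; first by rewrite invr_gt0 ltr0Sn.
  by exists k.
(* The index [ns i] is chosen after its predecessor, with tolerance [1 / (i + 1)]. *)
pose ns := fix ns i := if i is j.+1 then pick (i, (ns j).+1) else pick (0%N, 0%N).
exists ns => [i|]; first by have [] := pickP (i.+1, (ns i).+1).
have close i : `|u - x (ns i)| <= i.+1%:R^-1.
  by rewrite distrC; case: i => [|i]; [have [] := pickP (0%N, 0%N)|
    have [] := pickP (i.+1, (ns i).+1)].
apply/cvgrPdist_le => h h0.
apply: filterS ((cvgrPdist_le _ _).1 (@cvg_harmonic K) h h0) => i /=.
by rewrite sub0r normrN; apply: le_trans; rewrite (le_trans (close i)) // ler_norm.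
Qed.

Section Orbits.
Context {K : realType}.
Implicit Types (A s : K) (v : bool -> K) (x w : nat -> K).

(** For the iterates of a map, at [K = R], this is convertible to [omega_lim]. *)
Definition limit_set (z : nat -> K * K) : set (K * K) :=
  [set y | exists ns : nat -> nat, (forall i, (ns i < ns i.+1)%N) /\
     (fun i => z (ns i)) @ \oo --> y].

(** The endpoints are indexed by booleans so that the parity of a block selects one: [true] the
    left, [false] the right. *)
Definition segment v (b : K) : set (K * K) :=
  [set y | v true <= y.1 /\ y.1 <= v false /\ y.2 = b].

Lemma increasing_cvgy (ns : nat -> nat) :
  (forall i, (ns i < ns i.+1)%N) -> ns @ \oo --> \oo.
Proof.
move=> ns_incr; apply/cvgnyPge => N; exists N => // k /= Nk.
apply: (leq_trans Nk); elim: k {Nk} => [//|k IH].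
exact: (leq_ltn_trans IH (ns_incr k)).
Qed.

Lemma limit_set_segment x w v (b : K) : w @ \oo --> b ->
  (forall h : K, 0 < h ->
    exists N, forall k, (N <= k)%N -> v true - h <= x k /\ x k <= v false + h) ->
  (forall (u h : K) N, 0 < h -> v true <= u -> u <= v false ->
    exists2 k, (N <= k)%N & `|x k - u| <= h) ->
  limit_set (fun k => (x k, w k)) = segment v b.
Proof.
move=> wb confined hits; apply/seteqP; split=> [[u u']|[u u'] [/= vu [/= uv /= ->]]].
  move=> [ns [ns_incr nsu]] /=.
  have nsy := increasing_cvgy ns_incr.
  have xu : x \o ns @ \oo --> u.
    exact: (cvg_comp _ (@fst K K) nsu cvg_fst).
  have wu : w \o ns @ \oo --> u'.
    exact: (cvg_comp _ (@snd K K) nsu cvg_snd).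
  have bounds h : 0 < h -> v true - h <= u /\ u <= v false + h.
    move=> h0; have [N xN] := confined h h0.
    have nsN : \forall i \near \oo, (N <= ns i)%N by move/cvgnyPge : nsy; exact.
    split; [apply: (cvgr_to_ge xu)|apply: (cvgr_to_le xu)];
      by apply: filterS nsN => i /xN[].
  split; [|split].
  - by apply/ler_addgt0Pr => h /bounds[]; rewrite lerBlDr.
  - by apply/ler_addgt0Pr => h /bounds[].
  - by apply: (cvg_unique _ wu) => //; exact: (cvg_comp _ _ nsy wb).
have [ns ns_incr nsu] := subsequence_cvg (fun h N h0 => hits u h N h0 vu uv).
exists ns; split => //.
exact: (cvg_pair nsu (cvg_comp _ _ (increasing_cvgy ns_incr) wb)).
Qed.

(** Shows the step size to decay like [1 / k] along an arithmetic progression. *)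
Lemma squash_step A : 0 <= A -> (1 - squash A) / 2 = (2 * (1 + A))^-1.
Proof.
move=> A0; have := squash_norm A; rewrite (ger0_norm A0) ger0_norm => [->|].
  by field; lra.
by rewrite /squash ger0_norm // divr_ge0 // addr_ge0.
Qed.

(** The recursion is required only from height 1 on: there [squash] is at least 1/2, the range where
    [gain] is linear. *)
Lemma orbit_limit_set A s v x w (b : K) k1 : 0 < s -> s <= 1 / 20 ->
  (forall q, `|v q| <= 1) -> v true <= v false -> (forall k, `|x k| < 1) ->
  (forall k, (k1 <= k)%N -> 1 <= A + k%:R * s ->
    x k.+1 = steer (squash (A + k%:R * s) * v (odd (trunc_log 2 k)))
                   ((1 - squash (A + k%:R * s)) / 2) (x k)) ->
  w @ \oo --> b ->
  limit_set (fun k => (x k, w k)) = segment v b.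
Proof.
move=> s0 s20 v1 vv x1 xk wb.
pose e k := (1 - squash (A + k%:R * s)) / 2.
have [N _ AN] : \forall k \near \oo, 1 <= A + k%:R * s.
  have [n _ nA] : \forall k \near \oo, (1 - A) / s <= k%:R := nbhs_infty_ger _.
  exists n => // k /nA /=; rewrite ler_pdivrMr //; lra.
have {}AN k : (N <= k)%N -> 1 <= A + k%:R * s by exact: AN.
pose k0 := maxn k1 N.
have k0N k : (k0 <= k)%N -> 1 <= A + k%:R * s.
  by move=> kk; apply: AN; rewrite (leq_trans _ kk) ?leq_maxr.
have eE k : (k0 <= k)%N -> e k = (2 * (1 + (A + k%:R * s)))^-1.
  by move=> kk; rewrite /e squash_step //; have := k0N _ kk; lra.
have e_ge0 k : (k0 <= k)%N -> 0 <= e k.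
  by move=> kk; rewrite eE // invr_ge0; have := k0N _ kk; lra.
have e_step k : (k0 <= k)%N -> e k.+1 <= e k.
  move=> kk; have kk' : (k0 <= k.+1)%N by rewrite ltnW.
  have := k0N _ kk; have := k0N _ kk'; rewrite !eE // -!natr1 => ? ?.
  by rewrite lef_pV2 ?posrE; lra.
have e_cvg0 : e @ \oo --> (0 : K).
  apply/cvgrPdist_le => h h0.
  have [n _ nA] : \forall k \near \oo, (h^-1 - A) / s <= k%:R := nbhs_infty_ger _.
  exists (maxn n k0) => // k /=; rewrite geq_max => /andP[/nA /= nk kk].
  rewrite sub0r normrN ger0_norm ?e_ge0 // eE // invf_ple ?posrE //.
    move: nk; rewrite ler_pdivrMr //; have := k0N _ kk; lra.
  by have := k0N _ kk; lra.
pose t k := squash (A + k%:R * s) * v (odd (trunc_log 2 k)).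
have sq k : (k0 <= k)%N -> 0 <= squash (A + k%:R * s).
  move=> /k0N Ak; have A0 : 0 <= A + k%:R * s by lra.
  by rewrite /squash divr_ge0 // addr_ge0.
have t_margin k : (k0 <= k)%N -> `|t k| <= 1 - 2 * e k.
  move=> kk; rewrite normrM ger0_norm ?sq //.
  have -> : 1 - 2 * e k = squash (A + k%:R * s) by rewrite /e; field.
  by rewrite ler_piMr ?sq.
(* With [M = 2 ^ m] the claim reads [4 + 4 * A + 8 * M * s < M]. The bound on [s] makes [8 * M * s]
   at most [2 * M / 5], and [8 * (1 + |A|) < M] covers the rest. *)
have e_dyadic : \forall m \near \oo, 2 < (2 ^ m)%:R * e (2 ^ m.+1)%N.
  have [n _ nA] : \forall k \near \oo, 8 * (1 + `|A|) < k%:R := nbhs_infty_gtr _.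
  exists (maxn n k0) => // m /=; rewrite geq_max => /andP[/nA /= nm km].
  have mP : (m <= 2 ^ m)%N by rewrite ltnW // ltn_expl.
  have km' : (k0 <= 2 ^ m.+1)%N.
    by rewrite (leq_trans km) // (leq_trans mP) // leq_pexp2l.
  have mM : m%:R <= (2 ^ m)%:R :> K by rewrite ler_nat.
  have Ms : (2 ^ m)%:R * s <= (2 ^ m)%:R * (1 / 20) :> K by rewrite ler_wpM2l.
  have AA : A <= `|A| := ler_norm A.
  have := k0N _ km'; rewrite eE // expnS natrM -mulrA.
  move: ((2 ^ m)%:R * s) ((2 ^ m)%:R : K) Ms mM => P M Ms mM A1.
  by rewrite ltr_pdivlMr; lra.
have t_cvg : (fun k => t k - v (odd (trunc_log 2 k))) @ \oo --> (0 : K).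
  apply/cvgrPdist_le => h h0.
  have h20 : 0 < h / 2 by rewrite divr_gt0.
  have [n _ en] := (cvgrPdist_le _ _).1 e_cvg0 _ h20.
  exists (maxn n k0) => // k /=; rewrite geq_max => /andP[/en /= ek kk].
  move: ek; rewrite !sub0r !normrN (ger0_norm (e_ge0 _ kk)) => ek.
  have -> : t k - v (odd (trunc_log 2 k)) = - (2 * e k) * v (odd (trunc_log 2 k)).
    by rewrite /t /e; field.
  rewrite normrM normrN (ger0_norm (mulr_ge0 _ (e_ge0 _ kk))) //.
  apply: (le_trans (ler_piMr _ (v1 _))); first by rewrite mulr_ge0 // e_ge0.
  by move: (e k) ek => E; lra.
have x_step k : (k0 <= k)%N -> x k.+1 = steer (t k) (e k) (x k).
  move=> kk; apply: xk; last exact: k0N.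
  by rewrite (leq_trans _ kk) ?leq_maxl.
apply: limit_set_segment => // [h h0|u h n h0 vu uv].
  by apply: (@x_confined _ _ e t v k0) => // -[].
exact: (@x_hits _ _ e t v k0).
Qed.

End Orbits.

(** * Generic parameters and interpolation of the target *)

Section Genericity.
Context {K : realType}.

(** A countable set is Lebesgue null, while the interval has measure [d]. *)
Lemma avoid_countable (A : set K) (d : K) : countable A -> 0 < d ->
  exists r, [/\ 0 < r, r < d & ~ A r].
Proof.
move=> cA d0; apply: contrapT => no.
have sub : [set` `]0, d[] `<=` A.
  move=> r /=; rewrite in_itv /= => /andP[r0 rd]; apply: contrapT => Ar.
  by apply: no; exists r.
have := countable_lebesgue_measure0 (sub_countable (subset_card_le sub) cA).
rewrite lebesgue_measure_itv /= lte_fin d0 => /eqP.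
by rewrite sube0 eqe gt_eqF.
Qed.

Lemma countable_image2 {T1 T2 : Type} (A : set T1) (B : set T2) (f : T1 -> T2 -> K) :
  countable A -> countable B -> countable [set f p q | p in A & q in B].
Proof.
move=> cA cB; rewrite (_ : [set _ | _ in _ & _ in _] =
  (fun pq => f pq.1 pq.2) @` (A `*` B)); last first.
  apply/seteqP; split => [_ [p Ap [q Bq <-]]|_ [[p q] [Ap Bq] <-]].
    by exists (p, q).
  by exists p => //; exists q.
exact: (sub_countable (card_image_le _ _) (countableX cA cB)).
Qed.

(** For [|p.2| < 1], the point of the line that [squash] sends to the sheared coordinate
    [slide (c * p.1) p.2]. *)
Definition height (c : K) (p : K * K) : K := unsquash p.2 + c * p.1.

(** First [c] avoids the slopes giving two points the same height, then [s] avoids the quotients of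
    height differences by integers; both sets are countable. *)
Lemma generic_parameters (V : set (K * K)) : countable V ->
  (forall p, V p -> `|p.2| < 1) ->
  exists c s : K, [/\ 0 < s, s <= 1 / 20 &
    forall p q (k m : int), V p -> V q ->
      height c p + k%:~R * s = height c q + m%:~R * s -> p = q /\ k = m].
Proof.
move=> cV V1.
pose slope (p q : K * K) := (unsquash q.2 - unsquash p.2) / (p.1 - q.1).
have [c [_ _ cP]] := avoid_countable (countable_image2 slope cV cV) ltr01.
have inj p q : V p -> V q -> height c p = height c q -> p = q.
  move=> Vp Vq; rewrite /height => pq.
  (* On a common vertical, equal heights force equal points whatever [c] is. *)
  have [x12|x12] := eqVneq p.1 q.1.
    move: pq; rewrite x12 => /addIr u12.
    rewrite [p]surjective_pairing [q]surjective_pairing x12.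
    by rewrite -(unsquashK (V1 _ Vp)) u12 unsquashK ?V1.
  exfalso; apply: cP; exists p => //; exists q => //.
  have d0 : p.1 - q.1 != 0 by rewrite subr_eq0.
  apply: (mulIf d0); rewrite /slope divfK //; lra.
pose gap (pq : (K * K) * (K * K)) (k : int) :=
  (height c pq.1 - height c pq.2) / k%:~R.
have cgap := countable_image2 gap (countableX cV cV) (countableP [set: int]).
have d20 : 0 < 1 / 20 :> K by rewrite divr_gt0.
have [s [s0 s20 sP]] := avoid_countable cgap d20.
exists c, s; split => //; first exact: ltW.
move=> p q k m Vp Vq pq.
have [km|km] := eqVneq k m.
  by split => //; apply: inj => //; move: pq; rewrite km => /addIr.
exfalso; apply: sP; exists (p, q) => //; exists (m - k) => //.
have mk0 : (m - k)%:~R != 0 :> K by rewrite intr_eq0 subr_eq0 eq_sym.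
apply: (mulIf mk0); rewrite /gap divfK //= intrB; lra.
Qed.

Lemma near_dist_lt (r d : K) : 0 < d -> \forall y \near r, `|y - r| < d.
Proof.
move=> d0; apply/nbhs_ballP; exists d => // y.
by rewrite /ball /= distrC.
Qed.

(** Terms are [s] apart, so at most one lies within [s / 2] of [r]. *)
Lemma progression_isolated (a s r : K) : 0 < s ->
  \forall y \near r, forall k : int, y = a + k%:~R * s -> y = r.
Proof.
move=> s0.
have uniq (k m : int) : `|a + k%:~R * s - r| + `|a + m%:~R * s - r| < s -> k = m.
  move=> h; apply/eqP; rewrite -subr_eq0 -absz_eq0 -leqn0 -ltnS -ltz_nat abszE.
  rewrite -(ltr_int K) intr_norm intrB -(ltr_pM2r s0) mul1r -{1}(gtr0_norm s0).
  rewrite -normrM; apply: le_lt_trans h.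
  have -> : (k%:~R - m%:~R) * s = (a + k%:~R * s - r) - (a + m%:~R * s - r).
    by ring.
  exact: ler_normB.
(* If a term other than [r] is that close, its distance to [r] is the radius; otherwise [s / 2]
   is. *)
have [[k0 /andP[d0 ds]]|no] :=
  pselect (exists k : int, 0 < `|a + k%:~R * s - r| < s / 2).
- apply: filterS (near_dist_lt r d0) => y yd k yk.
  have kk : k = k0 by apply: uniq; rewrite -yk; lra.
  by move: yd; rewrite yk kk ltxx.
- have s20 : 0 < s / 2 by rewrite divr_gt0.
  apply: filterS (near_dist_lt r s20) => y yd k yk.
  apply/eqP; rewrite -subr_eq0 -normr_le0 leNgt; apply/negP => y0.
  by apply: no; exists k; rewrite -yk y0.
Qed.

(** Dropping the terms of absolute value below [idx p] leaves only finitely many progressions in a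
    bounded region. The union [E] is then closed and discrete, so any bounded data on it extend by
    Tietze's theorem. *)
Lemma interpolation (V : set (K * K)) (L : K * K -> K) (idx : K * K -> nat)
    (s : K) (pat : K * K -> int -> K) : 0 < s ->
  {in V &, injective idx} -> (forall p k, `|pat p k| <= 1) ->
  (forall p q (k m : int), V p -> V q ->
      L p + k%:~R * s = L q + m%:~R * s -> p = q /\ k = m) ->
  exists T : K -> K, [/\ continuous T, (forall t, `|T t| <= 1) &
    forall p (k : int), V p -> (idx p)%:R <= `|L p + k%:~R * s| ->
      T (L p + k%:~R * s) = pat p k].
Proof.
move=> s0 idx_inj pat1 L_inj.
pose at_ p (k : int) y :=
  [/\ V p, y = L p + k%:~R * s & (idx p)%:R <= `|y|].
pose E := [set y | exists p k, at_ p k y].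
(* Induction on [N]: since [idx] is injective, each index adds at most one progression. *)
have isolated_below (r : K) N : \forall y \near r, forall p, V p -> (idx p < N)%N ->
    forall k : int, y = L p + k%:~R * s -> y = r.
  elim: N => [|N IH]; first by apply: filterS (near_dist_lt r ltr01).
  have [[q [Vq qN]]|no] := pselect (exists q, V q /\ idx q = N).
    apply: (filterS2 _ _ IH (progression_isolated (L q) r s0)) => y yN yq p Vp.
    rewrite ltnS leq_eqVlt => /orP[/eqP pN|]; last exact: yN.
    have -> : p = q by apply: idx_inj; rewrite ?inE // pN qN.
    exact: yq.
  apply: filterS IH => y yN p Vp.
  rewrite ltnS leq_eqVlt => /orP[/eqP pN|]; last exact: yN.
  by exfalso; apply: no; exists p.
have isolated (r : K) : \forall y \near r, E y -> y = r.
  (* A term [y] within 1 of [r] satisfies [idx p <= |y| < |r| + 1 < N]. *)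
  have [N _ rN] : \forall k \near \oo, `|r| + 1 < k%:R := nbhs_infty_gtr _.
  apply: (filterS2 _ _ (isolated_below r N) (near_dist_lt r ltr01)) => y yN yr [p [k [Vp yk py]]].
  apply: (yN p Vp _ k yk); rewrite -(ltr_nat K).
  have yr' : `|y| <= `|y - r| + `|r| by rewrite -{1}(subrK r y) ler_normD.
  have := rN N (leqnn N); rewrite /=; lra.
have clE : closed E.
  by move=> r /(_ _ (isolated r))[y [Ey /(_ Ey) <-]].
(* By [L_inj] a point of [E] determines [p] and [k], so the choice is unambiguous there. *)
pose T0 y := xget 0 [set u | exists p k, at_ p k y /\ u = pat p k].
have T0E p k y : at_ p k y -> T0 y = pat p k.
  move=> pky; rewrite /T0.
  case: xgetP => [u _ [q [m [[Vq yq _] ->]]]|/(_ (pat p k))[]]; last by exists p, k.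
  case: pky => Vp yp _.
  by have [-> ->] := L_inj _ _ _ _ Vq Vp (etrans (esym yq) yp).
have T0_cont : {within E, continuous T0}.
  apply/subspace_continuousP => r Er; apply: cvg_near_cst.
  by rewrite near_withinE; apply: filterS (isolated r) => y yr Ey; rewrite yr.
have T01 y : E y -> `|T0 y| <= 1 by move=> [p [k /T0E ->]].
have [T [TE T_cont T1]] :=
  continuous_bounded_extension pseudometric_normal clE ltr01 T0_cont T01.
exists T; split => // p k Vp pk.
have pky : at_ p k (L p + k%:~R * s) by [].
by rewrite -TE ?(T0E p k) // inE; exists p, k.
Qed.

End Genericity.

(** * Limit sets of the skew product *)

Section PrescribedLimits.
Context {K : realType}.

(** The first projection of [C] is a bounded interval, closed as a preimage of [C] under
    [u |-> (u, b)]; it contains its infimum and supremum. *)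
Lemma connected_segment (b : K) (C : set (K * K)) :
  (forall y, C y -> `|y.1| <= 1 /\ y.2 = b) -> C !=set0 -> connected C -> closed C ->
  exists v : bool -> K,
    [/\ forall q, `|v q| <= 1, v true <= v false & C = segment v b].
Proof.
move=> Cb [[u0 b'] Cu0] conC clC.
have CE y : C y -> y = (y.1, b) by case: y => u u' /Cb[_ /= ->].
pose S : set K := [set u | C (u, b)].
have SE : S = fst @` C.
  apply/seteqP; split => [u Su|_ [y Cy <-]]; first by exists (u, b).
  by rewrite /S /= -CE.
have S0 : S u0 by rewrite /S /=; have := CE _ Cu0 => /= <-.
have S1 u : S u -> -1 <= u /\ u <= 1.
  by move=> /Cb[/=]; rewrite ler_norml => /andP[].
have itvS : is_interval S.
  apply/connected_intervalP; rewrite SE; apply: connected_continuous_connected => //.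
  by apply: continuous_subspaceT => y; exact: cvg_fst.
have pair_cont : continuous (fun u : K => (u, b)).
  by move=> u; exact: (cvg_pair cvg_id (cvg_cst b)).
have clS : closed S := (continuous_closedP _).1 pair_cont _ clC.
have ubS : has_ubound S by exists 1 => u /S1[].
have lbS : has_lbound S by exists (-1) => u /S1[].
have Ssup : S (sup S) by apply: clS; apply: closure_sup => //; exists u0.
have Sinf : S (inf S).
  apply: clS => B /nbhs_ballP[e /= e0 eB].
  have [|u Su ue] := @inf_adherent _ S e e0; first by split => //; exists u0.
  exists u; split => //; apply: eB; rewrite /ball /= distrC ger0_norm ?subr_ge0.
    by rewrite ltrBlDl.
  exact: ge_inf.
exists (fun q => if q then inf S else sup S); split.
- by move=> [] /=; rewrite ler_norml; apply/andP; exact: S1.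
- by rewrite /= (le_trans (ge_inf lbS S0)) // ub_le_sup.
- apply/seteqP; split => [y Cy|[u u'] [/= iu [us ->]]].
    have Sy : S y.1 by rewrite SE; exists y.
    by split; [exact: ge_inf|split; [exact: ub_le_sup|case: (Cb _ Cy)]].
  by apply: (itvS _ _ Sinf Ssup); rewrite iu us.
Qed.

(** A linear lower bound suffices, which tolerates the bounded shear term [c * x k]. *)
Lemma cvg_squash (s A : K) (u : nat -> K) : 0 < s ->
  (forall k, A + k%:R * s <= u k) -> squash \o u @ \oo --> (1 : K).
Proof.
move=> s0 Au; apply/cvgrPdist_le => h h0.
have [n _ nA] : \forall k \near \oo, (h^-1 - A) / s <= k%:R := nbhs_infty_ger _.
exists n => // k /nA /=; rewrite ler_pdivrMr // => kA.
have uh : h^-1 <= u k by have := Au k; lra.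
have h'0 : 0 < h^-1 by rewrite invr_gt0.
have u0 : 0 < u k by lra.
have -> : 1 - squash (u k) = (1 + u k)^-1.
  by rewrite /squash gtr0_norm //; field; lra.
rewrite ger0_norm ?invr_ge0 //; last lra.
by rewrite invf_ple ?posrE //; lra.
Qed.

Lemma squashN (t : K) : squash (- t) = - squash t.
Proof. by rewrite /squash normrN mulNr. Qed.

Lemma squash_ge_half (t : K) : 1 <= t -> 1 / 2 <= squash t.
Proof.
move=> t1; rewrite /squash ger0_norm; last lra.
by rewrite ler_pdivlMr; lra.
Qed.

Lemma target_squash (T : K -> K) t : target T (squash t) = `|squash t| * T t.
Proof. by rewrite /target squashK. Qed.

Section Orbit.
Variables (T : K -> K) (c s : K) (p : K * K).
Hypothesis T_le1 : forall t, `|T t| <= 1.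
Hypothesis p1_lt1 : `|p.1| < 1.
Hypothesis p2_lt1 : `|p.2| < 1.

Let L := height c p.
Let x k := (iter k (flow T c s) p).1.
Let z k := (iter k (flowV T c s) p).1.

Lemma flow_orbit k :
  iter k (flow T c s) p = (x k, squash (L + k%:R * s - c * x k)).
Proof.
elim: k => [|k IH].
  by rewrite mul0r addr0 /L /height addrK unsquashK // -surjective_pairing.
rewrite [LHS]surjective_pairing /x iterS IH; congr (_, _) => /=.
rewrite !slide_squash; congr squash; rewrite -natr1; ring.
Qed.

Lemma flow_orbit_step k : x k.+1 = push T (x k) (squash (L + k%:R * s)).
Proof.
by rewrite {1}/x iterS flow_orbit /= slide_squash subrK.
Qed.

Lemma flow_orbit_lt1 k : `|x k| < 1.
Proof.
elim: k => [//|k IH].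
by rewrite flow_orbit_step push_norm_lt // ltW // squash_norm_lt1.
Qed.

Lemma flowV_orbit k :
  iter k (flowV T c s) p = (z k, squash (L - k%:R * s - c * z k)).
Proof.
elim: k => [|k IH].
  by rewrite mul0r subr0 /L /height addrK unsquashK // -surjective_pairing.
rewrite [LHS]surjective_pairing /z iterS IH; congr (_, _) => /=.
rewrite !slide_squash; congr squash; rewrite -natr1; ring.
Qed.

(** The index is [k.+1] because [flowV] slides back before it pulls. *)
Lemma flowV_orbit_step k : z k.+1 = pull T (z k) (squash (L - k.+1%:R * s)).
Proof.
rewrite {1}/z iterS flowV_orbit /= !slide_squash subrK.
by congr (pull _ _ (squash _)); rewrite -natr1; ring.
Qed.

Lemma flowV_orbit_lt1 k : `|z k| < 1.
Proof.
elim: k => [//|k IH].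
by rewrite flowV_orbit_step pull_norm_lt // ltW // squash_norm_lt1.
Qed.

Variables (v : bool -> K) (n : nat).
Hypothesis s_gt0 : 0 < s.
Hypothesis s_le : s <= 1 / 20.
Hypothesis v_le1 : forall q, `|v q| <= 1.
Hypothesis v_ord : v true <= v false.

Lemma drift_bound (y : K) : `|y| < 1 -> `|c * y| <= `|c|.
Proof. by move=> /ltW y1; rewrite normrM ler_piMr. Qed.

Lemma flow_limit_set :
  (forall k : nat, n%:R <= L + k%:R * s ->
     T (L + k%:R * s) = v (odd (trunc_log 2 k))) ->
  limit_set (fun k => iter k (flow T c s) p) = segment v 1.
Proof.
move=> TL; rewrite (funext flow_orbit).
(* From [k1] on the height is at least [n], where [T] is prescribed. *)
have [k1 _ k1P] : \forall k \near \oo, (n%:R - L) / s <= k%:R := nbhs_infty_ger _.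
apply: (@orbit_limit_set _ L s v x _ _ k1) => //.
- exact: flow_orbit_lt1.
- move=> k /k1P /=; rewrite ler_pdivrMr // => nk L1.
  have q0 := squash_ge_half L1.
  have q1 := squash_norm_lt1 (L + k%:R * s).
  rewrite flow_orbit_step push_near1 ?(ltW (flow_orbit_lt1 k)) //; last first.
    by rewrite (le_trans (ler_norm _)) // ltW.
  by rewrite target_squash TL ?ger0_norm //; lra.
- apply: (@cvg_squash s (L - `|c|)) => // k.
  have := drift_bound (flow_orbit_lt1 k); rewrite ler_norml => /andP[_].
  by move: (c * x k) (k%:R * s) => r r' ?; lra.
Qed.

(** Reflecting the line turns the backward heights into the rising progression [s - L + k * s], and
    [pull] steers near -1 as [push] does near 1. *)
Lemma flowV_limit_set :
  (forall k : nat, n%:R <= - (L - k.+1%:R * s) ->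
     T (L - k.+1%:R * s) = v (odd (trunc_log 2 k))) ->
  limit_set (fun k => iter k (flowV T c s) p) = segment v (-1).
Proof.
move=> TL; rewrite (funext flowV_orbit).
have LE k : L - k.+1%:R * s = - (s - L + k%:R * s) by rewrite -natr1; ring.
have [k1 _ k1P] : \forall k \near \oo, (n%:R + L - s) / s <= k%:R := nbhs_infty_ger _.
apply: (@orbit_limit_set _ (s - L) s v z _ _ k1) => //.
- exact: flowV_orbit_lt1.
- move=> k /k1P /=; rewrite ler_pdivrMr // => nk L1.
  have q0 := squash_ge_half L1.
  have q1 := squash_norm_lt1 (s - L + k%:R * s).
  have TLk := TL k; rewrite LE opprK in TLk.
  rewrite flowV_orbit_step LE squashN pull_nearN1 ?(ltW (flowV_orbit_lt1 k)) //.
  + rewrite -squashN target_squash squashN normrN TLk; last lra.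
    by rewrite ger0_norm //; lra.
  + by rewrite opprK.
  + by rewrite opprK (le_trans (ler_norm _)) // ltW.
- have -> : (fun k => squash (L - k%:R * s - c * z k)) =
      (fun k => - (squash \o (fun k => - L + k%:R * s + c * z k)) k).
    apply/funext => k; rewrite /= -squashN; congr squash.
    by rewrite opprD opprD opprK.
  apply: cvgN; apply: (@cvg_squash s (- L - `|c|)) => // k.
  have := drift_bound (flowV_orbit_lt1 k); rewrite ler_norml => /andP[+ _].
  by move: (c * z k) (k%:R * s) => r r' ?; lra.
Qed.

End Orbit.

Lemma prescribed_limit_sets (V : set (K * K)) (om al : K * K -> bool -> K) :
  countable V -> (forall p, V p -> `|p.1| < 1 /\ `|p.2| < 1) ->
  (forall p q, `|om p q| <= 1) -> (forall p, om p true <= om p false) ->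
  (forall p q, `|al p q| <= 1) -> (forall p, al p true <= al p false) ->
  exists (T : K -> K) (c s : K), [/\ continuous T, (forall t, `|T t| <= 1) &
    forall p, V p ->
      limit_set (fun k => iter k (flow T c s) p) = segment (om p) 1 /\
      limit_set (fun k => iter k (flowV T c s) p) = segment (al p) (-1)].
Proof.
move=> cV V1 om1 omV al1 alV.
have [c [s [s0 s20 Linj]]] := generic_parameters cV (fun p Vp => (V1 p Vp).2).
have [idx idx_inj] := countable_injP _ cV.
(* [Negz n] stands for [-(n + 1)], matching the shifted index of the backward orbit. *)
pose pat p (k : int) := match k with
  | Posz n => om p (odd (trunc_log 2 n))
  | Negz n => al p (odd (trunc_log 2 n))
  end.
have pat1 p k : `|pat p k| <= 1 by case: k => k /=.
have [T [T_cont T1 TP]] := interpolation s0 idx_inj pat1 Linj.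
exists T, c, s; split => // p Vp; have [p1 p2] := V1 p Vp.
split.
- apply: (@flow_limit_set _ _ _ _ T1 p1 p2 _ (idx p)) => // k nk.
  have := TP p (Posz k) Vp; rewrite /= => -> //.
  exact: (le_trans nk (ler_norm _)).
- apply: (@flowV_limit_set _ _ _ _ T1 p1 p2 _ (idx p)) => // k nk.
  have := TP p (Negz k) Vp; rewrite /= NegzE mulrNz mulNr => -> //.
  by rewrite (le_trans nk) // -normrN ler_norm.
Qed.

End PrescribedLimits.

(** * Application to the given family of countable sets *)

Unset Implicit Arguments.

Theorem theorem3p5 (V : nat -> set (R * R))
  (Vcount : forall n, countable (V n))
  (Vsub : forall n, V n `<=` OpenSq)
  (Vdisj : forall m n, m <> n -> V m `&` V n = set0)
  (Vdense : forall n, J2 `<=` closure (V n))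
  (om : nat -> set (R * R)) (al : nat -> set (R * R))
  (omA : forall n, in_coll 1 (om n))
  (alA : forall n, in_coll (-1) (al n)) :
  exists phi phiinv : R * R -> R * R,
    homeo_with_inv J2 phi phiinv /\
    forall n x, V n x ->
      omega_lim phi x = om n /\ omega_lim phiinv x = al n.
Proof.
have J2E : J2 = [set p | `|p.1| <= 1 /\ `|p.2| <= 1].
  by apply/seteqP; split=> p; rewrite /J2 /J /= !in_itv /= -!ler_norml.
have coll_segment b C : in_coll b C -> exists v : bool -> R,
    [/\ forall q, `|v q| <= 1, v true <= v false & C = segment v b].
  case=> CJ C0 conC clC; apply: connected_segment => // y /CJ.
  by rewrite /Js /J /= in_itv /= -ler_norml => -[].
have /choice[omv omvP] n := coll_segment _ _ (omA n).
have /choice[alv alvP] n := coll_segment _ _ (alA n).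
pose W := \bigcup_n V n.
(* Disjointness makes [n] unique on [W]; elsewhere the default 0 merely makes the endpoint functions
   total. *)
pose index p := xget 0%N [set n | V n p].
have indexE n p : V n p -> index p = n.
  move=> Vnp; rewrite /index; case: xgetP => [m _ /= Vmp|/(_ n)//].
  apply: contrapT => /Vdisj mn.
  by have : (V m `&` V n) p by []; rewrite mn.
have cW : countable W by apply: bigcup_countable => // n _; exact: Vcount.
have W1 p : W p -> `|p.1| < 1 /\ `|p.2| < 1.
  by move=> [n _ /Vsub]; rewrite /OpenSq /= !in_itv /= -!ltr_norml.
have [T [c [s [T_cont T1 flowP]]]] := @prescribed_limit_sets _ W
  (omv \o index) (alv \o index) cW W1 (fun p => (let: And3 h _ _ := omvP (index p) in h))
  (fun p => (let: And3 _ h _ := omvP (index p) in h))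
  (fun p => (let: And3 h _ _ := alvP (index p) in h))
  (fun p => (let: And3 _ h _ := alvP (index p) in h)).
exists (flow T c s), (flowV T c s); split.
  rewrite J2E; split; first split.
  - exact: flow_stable.
  - exact: flowV_stable.
  - exact: flowK.
  - exact: flowVK.
  - by split; [exact: flow_continuous|exact: flowV_continuous].
move=> n p Vnp; have Wp : W p by exists n.
have [] := flowP p Wp; rewrite /= (indexE n p Vnp).
by have [_ _ ->] := omvP n; have [_ _ ->] := alvP n.
Qed.
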